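(* Let $G$ and $H$ be two graphs of order $n$ and $n'$, respectively. If neither $G$ nor $H$ has true twin vertices, and ($D(G)\le 2$ or neither $G$ nor $H$ has isolated vertices), then $\dim_s(G\oplus H)=\beta(G^c\boxtimes H^c)$.
   Context: All graphs are finite and simple; $G^c$ denotes the complement. Two vertices $x,y$ are true twins if $N_G[x]=N_G[y]$. The Cartesian sum $G\oplus H$ of $G=(V_1,E_1)$ and $H=(V_2,E_2)$ has vertex set $V_1\times V_2$, with $(a,b)(c,d)$ an edge iff $ac\in E_1$ or $bd\in E_2$. The strong product $G\boxtimes H$ has vertex set $V_1\times V_2$, with $(a,b)(c,d)$ an edge iff ($a=c$ and $bd\in E_2$) or ($b=d$ and $ac\in E_1$) or ($ac\in E_1$ and $bd\in E_2$). $D(G)$ is the diameter (infinite if $G$ is disconnected). For a connected graph $G$, a vertex $w$ strongly resolves $u,v$ if $d_G(w,u)=d_G(w,v)+d_G(v,u)$ or $d_G(w,v)=d_G(w,u)+d_G(u,v)$; $\dim_s(G)$ is the minimum cardinality of a set $S$ such that every pair of vertices is strongly resolved by some vertex of $S$. $\beta(G)$ is the vertex cover number.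
   Formalization: The formal theorem assumes that G has at least two vertices; without this the claim fails, e.g. for G = K_1 and H = P_4, where dim_s(G⊕H) = 1 but β(G^c⊠H^c) = 2. *)

(* Defs.v *)
From mathcomp Require Import all_boot.

Set Implicit Arguments.
Unset Strict Implicit.
Unset Printing Implicit Defensive.

Record sgraph := SGraph {
  vertex :> finType;
  edge : rel vertex;
  edge_sym : symmetric edge;
  edge_irrefl : irreflexive edge
}.

Definition compl_rel (G : sgraph) : rel G :=
  fun x y => (x != y) && ~~ edge x y.

Lemma compl_sym G : symmetric (@compl_rel G).
Proof. by move=> x y; rewrite /compl_rel eq_sym edge_sym. Qed.

Lemma compl_irrefl G : irreflexive (@compl_rel G).
Proof. by move=> x; rewrite /compl_rel eqxx. Qed.

Definition compl (G : sgraph) : sgraph :=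
  SGraph (@compl_sym G) (@compl_irrefl G).

Definition cart_sum_rel (G H : sgraph) : rel (G * H)%type :=
  fun p q => edge p.1 q.1 || edge p.2 q.2.

Lemma cart_sum_sym G H : symmetric (@cart_sum_rel G H).
Proof.
by move=> p q; rewrite /cart_sum_rel (edge_sym p.1) (edge_sym p.2).
Qed.

Lemma cart_sum_irrefl G H : irreflexive (@cart_sum_rel G H).
Proof. by move=> p; rewrite /cart_sum_rel !edge_irrefl. Qed.

Definition cart_sum (G H : sgraph) : sgraph :=
  SGraph (@cart_sum_sym G H) (@cart_sum_irrefl G H).

Definition strong_prod_rel (G H : sgraph) : rel (G * H)%type :=
  fun p q =>
    [|| (p.1 == q.1) && edge p.2 q.2,
        (p.2 == q.2) && edge p.1 q.1
      | edge p.1 q.1 && edge p.2 q.2].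

Lemma strong_prod_sym G H : symmetric (@strong_prod_rel G H).
Proof.
move=> p q; rewrite /strong_prod_rel.
by rewrite (edge_sym p.1) (edge_sym p.2) (eq_sym p.1) (eq_sym p.2).
Qed.

Lemma strong_prod_irrefl G H : irreflexive (@strong_prod_rel G H).
Proof. by move=> p; rewrite /strong_prod_rel !edge_irrefl !andbF. Qed.

Definition strong_prod (G H : sgraph) : sgraph :=
  SGraph (@strong_prod_sym G H) (@strong_prod_irrefl G H).

Section Invariants.

Variable G : sgraph.
Implicit Types (x y u v w : G) (S : {set G}).

Definition closed_nbhd x : {set G} := [set y | (y == x) || edge x y].

Definition true_twins x y : Prop := x <> y /\ closed_nbhd x = closed_nbhd y.

Definition has_true_twins : Prop := exists x y, true_twins x y.

Definition isolated x : Prop := forall y, ~~ edge x y.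

Definition has_isolated : Prop := exists x, isolated x.

Definition connected : bool := [forall x, forall y, connect (@edge G) x y].

Definition has_walk (k : nat) x y : bool :=
  [exists p : k.-tuple G, path (@edge G) x p && (last x p == y)].

(* None stands for an infinite distance. The search may stop at #|G| because a
   shortest walk does not repeat vertices; see dist_Some and dist_None. *)
Definition dist x y : option nat :=
  ohead [seq k <- iota 0 #|G| | has_walk k x y].

(* None stands for an infinite diameter. *)
Definition diam : option nat :=
  if connected then Some (\max_(x : G) \max_(y : G) odflt 0 (dist x y))
  else None.

Definition oaddn (a b : option nat) : option nat :=
  if a is Some m then omap (addn m) b else None.

Definition strongly_resolves w u v : bool :=
  (dist w u == oaddn (dist w v) (dist v u)) ||
  (dist w v == oaddn (dist w u) (dist u v)).

Definition strong_resolving_set S : bool :=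
  [forall u, forall v, (u != v) ==> [exists w in S, strongly_resolves w u v]].

(* None where the strong metric dimension is undefined, i.e. when G is not
   connected. *)
Definition strong_metric_dim : option nat :=
  if connected then
    Some #|[arg min_(S < [set: G] | strong_resolving_set S) #|S|]|
  else None.

Definition vertex_cover S : bool :=
  [forall x, forall y, edge x y ==> (x \in S) || (y \in S)].

Definition vertex_cover_number : nat :=
  #|[arg min_(S < [set: G] | vertex_cover S) #|S|]|.

End Invariants.

Definition le_ext (d : option nat) (k : nat) : bool :=
  if d is Some m then m <= k else false.

Section Sanity.

Variable G : sgraph.
Implicit Types (x y u v w : G) (S : {set G}).

Lemma has_walkP k x y :
  reflect (exists p, [/\ path (@edge G) x p, last x p = y & size p = k])
          (has_walk k x y).
Proof.
apply: (iffP existsP) => [[p /andP[pp /eqP lp]]|[p [pp lp sp]]].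
  by exists p; split => //; rewrite size_tuple.
have sp' : size p == k by apply/eqP.
by exists (Tuple sp'); rewrite /= pp lp eqxx.
Qed.

Lemma has_walk_shorten k x y :
  has_walk k x y -> exists2 j, j <= k & (j < #|G|) && has_walk j x y.
Proof.
case/has_walkP=> p [pp lp <-]; case/shortenP: pp lp => q pq uq sq lq.
exists (size q).
  by apply: uniq_leq_size sq; case/andP: uq.
apply/andP; split; last by apply/has_walkP; exists q.
by rewrite -[_.+1]/(size (x :: q)) -(card_uniqP uq) max_card.
Qed.

Lemma ohead_filter_iota (P : pred nat) m n k :
  ohead [seq i <- iota m n | P i] = Some k ->
  P k /\ forall j, m <= j -> P j -> k <= j.
Proof.
elim: n m => //= n IHn m; case: ifP => [Pm [<-] //|Pm /IHn[Pk kmin]].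
split=> // j; rewrite leq_eqVlt => /orP[/eqP<-|]; first by rewrite Pm.
exact: kmin.
Qed.

Lemma dist_None x y : dist x y = None <-> ~ connect (@edge G) x y.
Proof.
rewrite /dist; split.
  move=> d0 /connectP[p pp lp].
  have /has_walk_shorten[j _ /andP[jG wj]] : has_walk (size p) x y.
    by apply/has_walkP; exists p.
  have : j \in [seq k <- iota 0 #|G| | has_walk k x y].
    by rewrite mem_filter wj mem_iota.
  by case: [seq k <- _ | _] d0.
case E: (ohead _) => [k|//] nc; case: nc.
have [/has_walkP[p [pp lp _]] _] := ohead_filter_iota E.
by apply/connectP; exists p.
Qed.

Lemma dist_Some x y k :
  dist x y = Some k <-> has_walk k x y /\ forall j, has_walk j x y -> k <= j.
Proof.
split=> [/ohead_filter_iota[wk kmin]|[wk kmin]].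
  by split=> // j; apply: kmin.
case E: (dist x y) => [j|].
  have [wj jmin] := ohead_filter_iota E.
  by congr Some; apply/eqP; rewrite eqn_leq jmin // kmin.
case/dist_None: E; case/has_walkP: wk => p [pp lp _].
by apply/connectP; exists p.
Qed.

Lemma dist_refl x : dist x x = Some 0.
Proof. by apply/dist_Some; split=> //; apply/has_walkP; exists [::]. Qed.

Lemma strong_metric_dim_min k :
  strong_metric_dim G = Some k <->
  [/\ connected G, exists2 S : {set G}, strong_resolving_set S & #|S| = k
    & forall S : {set G}, strong_resolving_set S -> k <= #|S|].
Proof.
have setTr : strong_resolving_set [set: G].
  apply/forallP=> u; apply/forallP=> v; apply/implyP=> _.
  apply/existsP; exists u; rewrite inE /strongly_resolves dist_refl /=.
  by case: (dist u v) => //= d; rewrite eqxx orbT.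
rewrite /strong_metric_dim; case: (connected G); last by split=> // -[].
case: arg_minnP => // S rS Smin; split=> [[<-]|[_ [T rT <-] Tmin]].
  by split=> //; exists S.
by congr Some; apply/eqP; rewrite eqn_leq Smin // Tmin.
Qed.

Lemma vertex_cover_number_min k :
  vertex_cover_number G = k <->
  (exists2 S : {set G}, vertex_cover S & #|S| = k) /\
  forall S : {set G}, vertex_cover S -> k <= #|S|.
Proof.
have setTc : vertex_cover [set: G].
  by apply/forallP=> x; apply/forallP=> y; rewrite !inE implybT.
rewrite /vertex_cover_number; case: arg_minnP => // S cS Smin.
split=> [<-|[[T cT <-] Tmin]]; first by split=> //; exists S.
by apply/eqP; rewrite eqn_leq Smin // Tmin.
Qed.

End Sanity.

(* Main.v *)
Require Import Defs.
From mathcomp Require Import all_boot.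

Set Implicit Arguments.
Unset Strict Implicit.
Unset Printing Implicit Defensive.

(** In a graph [K] of diameter at most 2, a non-adjacent pair is strongly
    resolved only by its own two vertices, so a strong resolving set of [K] is a
    vertex cover of the complement of [K]. Conversely, if [K] has no true twins,
    then every edge [uv] has a vertex [w] adjacent to exactly one end, say [v]; a
    vertex cover of the complement contains [w] or [u], and both resolve [u, v].
    The Cartesian sum satisfies both conditions and its complement is the strong
    product of the complements. *)

(** Diameter at most 2, phrased without distances; it entails connectedness. *)
Definition common_nbr (K : sgraph) :=
  forall x y : K, x != y -> ~~ edge x y -> exists z, edge x z && edge z y.

Lemma connected_edge (K : sgraph) (x : K) :
  connected K -> 1 < #|K| -> exists y, edge x y.
Proof.
move=> /forallP/(_ x)/forallP cK /card_gt1P[a [b [_ _ ab]]].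
have [y xy] : exists y, x != y.
  have [xa|] := eqVneq x a; last by exists a.
  by exists b; rewrite xa.
case/connectP: (cK y) => -[|z p] /= => [_ yx|/andP[xz _] _].
  by rewrite yx eqxx in xy.
by exists z.
Qed.

(** A shortest walk has length at most 2; lengths 0 and 1 are excluded, so its middle vertex is the
    common neighbour. *)
Lemma diam_common_nbr (K : sgraph) : le_ext (diam K) 2 -> common_nbr K.
Proof.
rewrite /diam; case cK: (connected K) => //= diam2 x y xy nxy.
case E: (dist x y) => [k|]; last first.
  by case/dist_None: E; move/forallP/(_ x)/forallP: cK; apply.
have k2 : k <= 2.
  apply: leq_trans diam2; apply: leq_trans (leq_bigmax x).
  by apply: leq_trans (leq_bigmax y); rewrite E.
have [/has_walkP[p [pp lp sp]] _] := (dist_Some x y k).1 E.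
rewrite -{}sp {E diam2} in k2.
case: p k2 pp lp => [|a [|b [|//]]] _ //=.
- by move=> _ E; rewrite E eqxx in xy.
- by rewrite andbT => xa E; rewrite -E xa in nxy.
by case/and3P=> xa ab _ <-; exists a; rewrite xa.
Qed.

Lemma no_twinsP (K : sgraph) (x y : K) : ~ has_true_twins K -> x != y ->
  exists z, (z \in closed_nbhd x) != (z \in closed_nbhd y).
Proof.
move=> nt xy; apply/existsP; apply: contra_notT nt.
rewrite negb_exists => /forallP tw; exists x, y; split; first exact/eqP.
by apply/setP=> z; apply/eqP; rewrite -[_ == _]negbK.
Qed.

Section DiameterTwo.

Variable K : sgraph.
Hypothesis nbr : common_nbr K.
Implicit Types (u v w : K) (S : {set K}).

Lemma dist_common_nbr u v :
  dist u v = Some (if u == v then 0 else if edge u v then 1 else 2).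
Proof.
have [<-|uv] := eqVneq; first exact: dist_refl.
apply/dist_Some; case: ifPn => euv; split.
- by apply/has_walkP; exists [:: v]; rewrite /= euv.
- case=> // /has_walkP[p [_ lp /size0nil p0]].
  by move: lp uv; rewrite p0 => /= ->; rewrite eqxx.
- have [z /andP[uz zv]] := nbr uv euv.
  by apply/has_walkP; exists [:: z; v]; rewrite /= uz zv.
case=> [|[|//]] /has_walkP[p [pp lp sp]].
  by move/size0nil: sp lp uv => -> /= ->; rewrite eqxx.
case: p pp lp sp => [|a [|//]] //=; rewrite andbT => ua av _.
by rewrite -av ua in euv.
Qed.

Lemma strong_resolving_set_compl_cover S : strong_resolving_set S ->
  vertex_cover (G := compl K) S.
Proof.
move=> /forallP rS; apply/forallP=> u; apply/forallP=> v.
apply/implyP=> /andP[uv euv].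
move/(_ u)/forallP/(_ v): rS; rewrite uv /= => /existsP[w /andP[wS]].
rewrite /strongly_resolves !dist_common_nbr /= [v == u]eq_sym [@edge K v u]edge_sym.
rewrite (negPf uv) (negPf (euv : ~~ @edge K u v)) /=.
have [<-|wu] := eqVneq w u; first by rewrite wS.
have [<-|wv] := eqVneq w v; first by rewrite wS orbT.
(* Here [w] is at distance 1 or 2 from both [u] and [v], and these are at distance 2, so neither
   equation can hold. *)
by do 2!case: (edge w _).
Qed.

Lemma compl_cover_strong_resolving_set S : ~ has_true_twins K ->
  vertex_cover (G := compl K) S -> strong_resolving_set S.
Proof.
move=> nt /forallP cS.
have cover x y : x != y -> ~~ edge x y -> (x \in S) || (y \in S).
  by move=> xy nxy; apply: (implyP (forallP (cS x) y)); apply/andP.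
have res_end u v : strongly_resolves u u v /\ strongly_resolves v u v.
  by rewrite /strongly_resolves !dist_refl !dist_common_nbr /= !eqxx orbT.
have res u v w : u != v -> edge u v -> w \in closed_nbhd v ->
    w \notin closed_nbhd u -> exists2 x, x \in S & strongly_resolves x u v.
  move=> uv euv; rewrite !inE negb_or => wv /andP[wu nwu].
  have wv' : w != v by apply: contraNneq nwu => ->.
  move: wv; rewrite (negPf wv') /= edge_sym => ewv.
  rewrite edge_sym in nwu.
  case/orP: (cover _ _ wu nwu) => [wS|uS]; last first.
    by exists u => //; have [] := res_end u v.
  (* The path from [w] through [v] to [u] is a geodesic: 2 = 1 + 1. *)
  exists w => //; rewrite /strongly_resolves !dist_common_nbr.
  rewrite (negPf wu) (negPf wv') (negPf nwu) ewv.
  by rewrite [v == u]eq_sym (negPf uv) [edge v u]edge_sym euv.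
apply/forallP=> u; apply/forallP=> v; apply/implyP=> uv.
suff [w wS rw] : exists2 w, w \in S & strongly_resolves w u v.
  by apply/existsP; exists w; rewrite wS.
have [euv|nuv] := boolP (edge u v); last first.
  by case/orP: (cover _ _ uv nuv) => ?; [exists u|exists v];
    have [] := res_end u v.
have [w] := no_twinsP nt uv.
case wu: (w \in closed_nbhd u); case wv: (w \in closed_nbhd v) => // _; last first.
  by apply: (res u v w); rewrite ?wu.
(* Now [w] is adjacent or equal to [u] only, so [u] and [v] exchange roles. *)
have [|||| x xS rx] := res v u w; rewrite ?wv //.
- by rewrite eq_sym.
- by rewrite edge_sym.
by exists x => //; rewrite /strongly_resolves orbC.
Qed.

Lemma common_nbr_connected : connected K.
Proof.
apply/forallP=> x; apply/forallP=> y; apply/negPn/negP.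
by move/negP/dist_None; rewrite dist_common_nbr.
Qed.

(** Strong resolving sets of [K] and vertex covers of its complement are the same sets. *)
Lemma strong_metric_dim_compl : ~ has_true_twins K ->
  strong_metric_dim K = Some (vertex_cover_number (compl K)).
Proof.
move=> nt; apply/strong_metric_dim_min.
have [[S cS Sk] Smin] := (vertex_cover_number_min (compl K) _).1 erefl.
split; first exact: common_nbr_connected.
  by exists S => //; apply: compl_cover_strong_resolving_set.
by move=> T /strong_resolving_set_compl_cover/Smin.
Qed.

End DiameterTwo.

(** Either side says that [p] and [q] differ and that, in each coordinate, they are equal or
    non-adjacent. *)
Lemma compl_cart_sumE (G H : sgraph) (p q : G * H) :
  @edge (compl (cart_sum G H)) p q =
  @edge (strong_prod (compl G) (compl H)) p q.
Proof.
case: p q => [a b] [c d].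
rewrite /= /compl_rel /cart_sum_rel /strong_prod_rel /= /compl_rel xpair_eqE.
have [->|_] := eqVneq a c; have [->|_] := eqVneq b d;
  by rewrite ?negb_or ?andbT ?andbF ?orbF //= edge_irrefl ?andbT.
Qed.

Lemma vertex_cover_number_compl_cart_sum (G H : sgraph) :
  vertex_cover_number (compl (cart_sum G H)) =
  vertex_cover_number (strong_prod (compl G) (compl H)).
Proof.
have coverE (S : {set G * H}) :
    vertex_cover (G := compl (cart_sum G H)) S =
    vertex_cover (G := strong_prod (compl G) (compl H)) S.
  by apply: eq_forallb => p; apply: eq_forallb => q; rewrite compl_cart_sumE.
apply/vertex_cover_number_min.
have [[S cS Sk] Smin] :=
  (vertex_cover_number_min (strong_prod (compl G) (compl H)) _).1 erefl.
split; first by exists S; rewrite ?coverE.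
by move=> T; rewrite coverE => /Smin.
Qed.

Lemma cart_sum_common_nbr (G H : sgraph) : 1 < #|G| ->
  le_ext (diam G) 2 \/ (~ has_isolated G /\ ~ has_isolated H) ->
  common_nbr (cart_sum G H).
Proof.
move=> G1 [diam2|[niG niH]] [a b] [c d] pq.
  rewrite /= /cart_sum_rel /= negb_or => /andP[nac _].
  have [e /andP[ae ec]] : exists e, edge a e && edge e c.
    (* If [a = c], any neighbour of [c] serves; one exists since [G] is connected with at least two
       vertices. *)
    have [->|ac] := eqVneq a c; last exact: diam_common_nbr.
    have cG : connected G by move: diam2; rewrite /diam; case: ifP.
    by have [e ce] := connected_edge c cG G1; exists e; rewrite ce edge_sym.
  by exists (e, b); rewrite ae ec.
have nbr (L : sgraph) (x : L) : ~ has_isolated L -> exists y, edge x y.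
  move=> niL; apply/existsP; apply: contra_notT niL.
  by rewrite negb_exists => /forallP iso; exists x.
(* The vertex [(e, f)] meets [(a, b)] through the first coordinate and [(c, d)] through the
   second. *)
move=> _; have [e ae] := nbr G a niG; have [f df] := nbr H d niH.
by exists (e, f); rewrite /= /cart_sum_rel /= ae [edge f d]edge_sym df orbT.
Qed.

(** True twins are adjacent, so their coordinates are adjacent in [G] or in [H]; a vertex separating
    these coordinates in that factor yields a contradiction. *)
Lemma cart_sum_no_twins (G H : sgraph) :
  ~ has_true_twins G -> ~ has_true_twins H -> ~ has_true_twins (cart_sum G H).
Proof.
move=> ntG ntH [[a b] [[c d] [pq /setP tw]]].
have : ((c, d) : cart_sum G H) \in closed_nbhd (G := cart_sum G H) (a, b).
  by rewrite tw inE eqxx.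
rewrite inE /= /cart_sum_rel /= => /orP[/eqP cd|]; first by case: pq.
case/orP=> [ac|bd].
- have ne : a != c by apply: contraTneq ac => ->; rewrite edge_irrefl.
  have [x] := no_twinsP ntG ne.
  (* For [x] other than [a] and [c], the test at [(x, b)] shows that [edge c x] implies [edge a x],
     and the test at [(x, d)] the converse, whether or not [b] and [d] are adjacent. *)
  have := tw (x, b); have := tw (x, d).
  rewrite !inE /= /cart_sum_rel /= !edge_irrefl !xpair_eqE !eqxx ?andbT ?orbF.
  have [->|xa] := eqVneq x a; first by rewrite (edge_sym c) ac orbT.
  have [->|xc] := eqVneq x c; first by rewrite ac.
  by case: (edge a x); case: (edge c x).
have ne : b != d by apply: contraTneq bd => ->; rewrite edge_irrefl.
have [y] := no_twinsP ntH ne.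
have := tw (a, y); have := tw (c, y).
rewrite !inE /= /cart_sum_rel /= !edge_irrefl !xpair_eqE !eqxx /=.
have [->|yb] := eqVneq y b; first by rewrite (edge_sym d) bd orbT.
have [->|yd] := eqVneq y d; first by rewrite bd.
by rewrite !andbF; case: (edge b y); case: (edge d y); rewrite ?orbT ?orbF.
Qed.

Theorem theorem3 (G H : sgraph)
    (G_nontrivial : 1 < #|G|)
    (G_twins : ~ has_true_twins G) (H_twins : ~ has_true_twins H)
    (GH_cond : le_ext (diam G) 2 \/ (~ has_isolated G /\ ~ has_isolated H)) :
  strong_metric_dim (cart_sum G H) =
    Some (vertex_cover_number (strong_prod (compl G) (compl H))).
Proof.
rewrite strong_metric_dim_compl ?vertex_cover_number_compl_cart_sum //.
  exact: cart_sum_common_nbr.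
exact: cart_sum_no_twins.
Qed.
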